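(* Let $m_1,m_2\in\mathbb{R}$. If $p_1\in S^{m_1}$ and $p_2\in S^{m_2}$, then $p_1p_2\in S^{m_1+m_2}$ and $$p_1(-\Delta)\circ p_2(-\Delta)=(p_1p_2)(-\Delta).$$
   Context: Setting. $(X,R)$ is a metric space with a Borel measure $\mu$ that is doubling: there is $C>0$ with $\mu(B(x,2r))\le C\mu(B(x,r))$ for all $x\in X$, $r>0$. $\Delta$ is a non-positive self-adjoint operator (the Laplacian) on $L^2(\mu)$ such that the heat operator $e^{t\Delta}$ has a positive kernel $h_t(x,y)$ satisfying $h_t(x,y)\le c_1 t^{-\beta}\exp\left(-c_2\left(R(x,y)^{d+1}/t\right)^{\gamma}\right)$ for all $t>0$, where $c_1,c_2>0$ are independent of $t,x,y$, the constants $d,\gamma>0$ depend on $X$ and $\beta=d/(d+1)$; moreover $h_z(x,y)$ is holomorphic on $\{\operatorname{Re}z>0\}$. $P(\lambda)$ is the spectral resolution of $-\Delta$. For $m\in\mathbb{R}$, the symbol class $S^m$ is the set of $p\in C^\infty((0,\infty))$ such that for every integer $k\ge0$ there is $C_k>0$ with $\left|\left(\lambda\frac{d}{d\lambda}\right)^kp(\lambda)\right|\le C_k(1+\lambda)^{\frac{m}{d+1}}$ for all $\lambda>0$. For a bounded Borel function $p$ on $(0,\infty)$, $p(-\Delta)u=\int_0^\infty p(\lambda)\,dP(\lambda)u$; for $p\in S^m$ with $m>0$, $q(\lambda)=(1+\lambda)^{-\frac{m}{d+1}}p(\lambda)$ is bounded and $p(-\Delta)=(I-\Delta)^{\frac{m}{d+1}}q(-\Delta)$.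 The operator identity in the claim is understood on those $u$ for which both sides are defined. *)

(* Defs.v *)
From HB Require Import structures.
From mathcomp Require Import all_boot all_order all_algebra.
From mathcomp Require Import all_classical all_reals all_analysis.
From mathcomp.real_closed Require Import complex.
From mathcomp Require Import ring.
Set Implicit Arguments.
Unset Strict Implicit.
Unset Printing Implicit Defensive.
Import Order.TTheory GRing.Theory Num.Theory.
Import numFieldNormedType.Exports.
Local Open Scope classical_set_scope.
Local Open Scope ring_scope.
Local Open Scope complex_scope.
Local Open Scope quotient_scope.

Notation Rep f := (fun x => complex.Re (f x)).
Notation Imp f := (fun x => complex.Im (f x)).

Section L2fun.
Context {d : measure_display} {T : measurableType d} {R : realType}.
Variable mu : {measure set T -> \bar R}.

Definition cintegrable (f : T -> R[i]) : Prop :=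
  mu.-integrable setT (EFin \o Rep f) /\ mu.-integrable setT (EFin \o Imp f).

Definition cintegral (f : T -> R[i]) : R[i] :=
  (\int[mu]_x complex.Re (f x)) +i* (\int[mu]_x complex.Im (f x)).

Definition L2pred : {pred T -> R[i]} :=
  fun f => (Rep f \in Lfun mu 2%:E) && (Imp f \in Lfun mu 2%:E).

Let L2pred_submod : submod_closed L2pred.
Proof.
have p1 : (1 <= 2%:E :> \bar R)%E by rewrite lee_fin ler1n.
have [z l] := Lfun_submod_closed mu p1.
split=> [|a f g]; first by rewrite unfold_in; apply/andP; split; exact: z.
rewrite !unfold_in => /andP[f1 f2] /andP[g1 g2]; apply/andP; split.
  have -> : Rep (a *: f + g) =
      complex.Re a *: (Rep f) + ((- complex.Im a) *: (Imp f) + Rep g).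
    apply/funext => x /=.
    rewrite !fctE /= /GRing.scale /=; case: a (f x) (g x) => [a b] [u v] [s t] /=.
    by rewrite mulNr addrA.
  by apply: (l) => //; apply: (l).
have -> : Imp (a *: f + g) =
    complex.Re a *: (Imp f) + (complex.Im a *: (Rep f) + Imp g).
  apply/funext => x /=.
  rewrite !fctE /= /GRing.scale /=; case: a (f x) (g x) => [a b] [u v] [s t] /=.
  by rewrite addrA.
by apply: (l) => //; apply: (l).
Qed.

HB.instance Definition _ := GRing.isSubmodClosed.Build _ _ L2pred L2pred_submod.

Record L2fun := MkL2fun { L2val :> T -> R[i]; _ : L2val \in L2pred }.

HB.instance Definition _ := [isSub for L2val].
HB.instance Definition _ := [Choice of L2fun by <:].
HB.instance Definition _ := [SubChoice_isSubLmodule of L2fun by <:].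

Definition L2ae_eq (f g : L2fun) : bool := `[< \forall x \ae mu, f x = g x >].

Let L2ae_refl : reflexive L2ae_eq.
Proof. by move=> f; apply/asboolP; exact: aeW. Qed.

Let L2ae_sym : symmetric L2ae_eq.
Proof.
by move=> f g; apply/idP/idP => /asboolP h; apply/asboolP;
  apply: filterS h => x ->.
Qed.

Let L2ae_trans : transitive L2ae_eq.
Proof.
move=> f g h /asboolP gf /asboolP fh; apply/asboolP.
by apply: filterS2 gf fh => x -> ->.
Qed.

Canonical L2ae_equiv := EquivRel L2ae_eq L2ae_refl L2ae_sym L2ae_trans.

(* Elements of [L2] are classes modulo almost everywhere equality; they coerce
   to functions through a choice of representative. *)
Definition L2 : Type := {eq_quot L2ae_eq}.
HB.instance Definition _ := Choice.on L2.
HB.instance Definition _ := EqQuotient.on L2.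
Definition L2repr (u : L2) : T -> R[i] := L2val (repr u).
Coercion L2repr : L2 >-> Funclass.

Lemma L2_piP (f g : L2fun) :
  \pi_L2 f = \pi_L2 g <-> \forall x \ae mu, f x = g x.
Proof.
by split => [/eqP|h]; [rewrite eqmodE => /asboolP|
  apply/eqP; rewrite eqmodE; apply/asboolP].
Qed.

Lemma L2_reprK (f : L2fun) : \forall x \ae mu, (\pi_L2 f : L2) x = f x.
Proof. by apply/L2_piP; rewrite reprK. Qed.

Lemma L2P (u v : L2) : u = v <-> \forall x \ae mu, u x = v x.
Proof.
by split=> [->|/L2_piP]; [exact: aeW|rewrite !reprK].
Qed.

Let add (u v : L2) : L2 := \pi_L2 (repr u + repr v).
Let opp (u : L2) : L2 := \pi_L2 (- repr u).
Let scale (a : R[i]) (u : L2) : L2 := \pi_L2 (a *: repr u).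
Let zero : L2 := \pi_L2 0.

Let addE u v : \forall x \ae mu, add u v x = u x + v x.
Proof. exact: L2_reprK. Qed.
Let oppE u : \forall x \ae mu, opp u x = - u x.
Proof. exact: L2_reprK. Qed.
Let scaleE a u : \forall x \ae mu, scale a u x = a * u x.
Proof. exact: L2_reprK. Qed.
Let zeroE : \forall x \ae mu, zero x = 0.
Proof. exact: L2_reprK. Qed.

Let aeI (P Q : T -> Prop) : (\forall x \ae mu, P x) ->
  (\forall x \ae mu, Q x) -> \forall x \ae mu, P x /\ Q x.
Proof. by apply: filterS2 => x Px Qx; split. Qed.

Let addA : associative add.
Proof.
move=> u v w; apply/L2P.
have h1 := aeI (addE u (add v w)) (addE v w).
have h2 := aeI (addE (add u v) w) (addE u v).
by apply: filterS2 h1 h2 => x [-> ->] [-> ->]; rewrite addrA.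
Qed.

Let addC : commutative add.
Proof.
move=> u v; apply/L2P.
by apply: filterS2 (addE u v) (addE v u) => x -> ->; rewrite addrC.
Qed.

Let add0 : left_id zero add.
Proof.
move=> u; apply/L2P.
by apply: filterS2 (addE zero u) zeroE => x -> ->; rewrite add0r.
Qed.

Let addN : left_inverse zero opp add.
Proof.
move=> u; apply/L2P.
by apply: filterS3 (addE (opp u) u) (oppE u) zeroE => x -> -> ->; rewrite addNr.
Qed.

HB.instance Definition _ := GRing.isZmodule.Build L2 addA addC add0 addN.

Lemma L2addE (u v : L2) : \forall x \ae mu, (u + v : L2) x = u x + v x.
Proof. exact: addE. Qed.
Lemma L2oppE (u : L2) : \forall x \ae mu, (- u : L2) x = - u x.
Proof. exact: oppE. Qed.

Let scaleA a b (u : L2) : scale a (scale b u) = scale (a * b) u.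
Proof.
apply/L2P.
by apply: filterS3 (scaleE a (scale b u)) (scaleE b u) (scaleE (a * b) u)
  => x -> -> ->; rewrite mulrA.
Qed.

Let scale1 : left_id 1 scale.
Proof.
by move=> u; apply/L2P; apply: filterS (scaleE 1 u) => x ->; rewrite mul1r.
Qed.

Let scaleDr : right_distributive scale +%R.
Proof.
move=> a u v; apply/L2P.
have h1 := aeI (scaleE a (u + v)) (L2addE u v).
have h2 := aeI (scaleE a u) (scaleE a v).
by apply: filterS3 h1 h2 (L2addE (scale a u) (scale a v)) =>
  x [-> ->] [e1 e2] ->; rewrite mulrDr e1 e2.
Qed.

Let scaleDl (u : L2) : {morph scale^~ u : a b / a + b}.
Proof.
move=> a b; apply/L2P.
have h := aeI (scaleE a u) (scaleE b u).
by apply: filterS3 h (scaleE (a + b) u) (L2addE (scale a u) (scale b u)) =>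
  x [e1 e2] -> ->; rewrite mulrDl e1 e2.
Qed.

HB.instance Definition _ :=
  GRing.Zmodule_isLmodule.Build R[i] L2 scaleA scale1 scaleDr scaleDl.

Lemma L2scaleE a (u : L2) : \forall x \ae mu, (a *: u : L2) x = a * u x.
Proof. exact: scaleE. Qed.

Definition L2dot (u v : L2) : R[i] := cintegral (fun x => u x * (v x)^*).

Definition L2norm (u : L2) : R := Num.sqrt (complex.Re (L2dot u u)).

Lemma L2_Re (u : L2) : Rep u \in Lfun mu 2%:E.
Proof. by have := valP (repr u); rewrite unfold_in => /andP[]. Qed.

Lemma L2_Im (u : L2) : Imp u \in Lfun mu 2%:E.
Proof. by have := valP (repr u); rewrite unfold_in => /andP[]. Qed.

Lemma L2_dot_integrable (u v : L2) : cintegrable (fun x => u x * (v x)^*).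
Proof.
have int f g : f \in Lfun mu 2%:E -> g \in Lfun mu 2%:E ->
    mu.-integrable setT (EFin \o (f \* g)).
  by move=> fL gL; apply/Lfun1_integrable; exact: Lfun2_mul_Lfun1.
split.
  have -> : EFin \o Rep (fun x => u x * (v x)^*) =
     ((EFin \o (Rep u \* Rep v)%R) \+ (EFin \o (Imp u \* Imp v)%R))%E.
    apply/funext => x /=; case: (u x) (v x) => [a b] [s t] /=.
    by rewrite -EFinD mulrN opprK.
  by apply: integrableD => //; apply: int; [exact: L2_Re|exact: L2_Re
    |exact: L2_Im|exact: L2_Im].
have -> : EFin \o Imp (fun x => u x * (v x)^*) =
   ((EFin \o (Imp u \* Rep v)%R) \- (EFin \o (Rep u \* Imp v)%R))%E.
  apply/funext => x /=; case: (u x) (v x) => [a b] [s t] /=.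
  by rewrite -EFinB mulrN addrC.
by apply: integrableB => //; apply: int; [exact: L2_Im|exact: L2_Re
  |exact: L2_Re|exact: L2_Im].
Qed.

Lemma L2dotDl (u v w : L2) : L2dot (u + v) w = L2dot u w + L2dot v w.
Proof.
have [i1 i2] := L2_dot_integrable u w.
have [j1 j2] := L2_dot_integrable v w.
have [k1 k2] := L2_dot_integrable (u + v) w.
rewrite /L2dot /cintegral.
transitivity ((\int[mu]_x (complex.Re (u x * (w x)^*) + complex.Re (v x * (w x)^*)))
  +i* (\int[mu]_x (complex.Im (u x * (w x)^*) + complex.Im (v x * (w x)^*)))).
  congr (_ +i* _); congr fine; apply: ae_eq_integral => //.
  - exact: measurable_int k1.
  - exact: measurable_int (integrableD _ i1 j1).
  - apply: filterS (L2addE u v) => x -> _ /=; congr (_%:E).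
    by rewrite mulrDl raddfD.
  - exact: measurable_int k2.
  - exact: measurable_int (integrableD _ i2 j2).
  - apply: filterS (L2addE u v) => x -> _ /=; congr (_%:E).
    by rewrite mulrDl raddfD.
by rewrite !RintegralD.
Qed.

Lemma L2dotC (u v : L2) : L2dot v u = (L2dot u v)^*.
Proof.
have [i1 i2] := L2_dot_integrable u v.
rewrite /L2dot /cintegral /=; congr (_ +i* _).
  by apply: eq_Rintegral => x _; case: (u x) (v x) => [a b] [s t] /=;
    rewrite !mulrN !opprK (mulrC s) (mulrC t).
rewrite -mulN1r -RintegralZl//; apply: eq_Rintegral => x _.
case: (u x) (v x) => [a b] [s t] /=.
by rewrite mulN1r !mulrN opprD opprK (mulrC s) (mulrC t) addrC.
Qed.

Lemma L2dot_ge0 (u : L2) : 0 <= complex.Re (L2dot u u).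
Proof.
rewrite /L2dot /=; apply: Rintegral_ge0 => x _; case: (u x) => a b /=.
by rewrite mulrN opprK addr_ge0// -expr2 sqr_ge0.
Qed.

Lemma L2norm_sqr (u : L2) : L2norm u ^+ 2 = complex.Re (L2dot u u).
Proof. by rewrite sqr_sqrtr// L2dot_ge0. Qed.

Lemma L2dotNl (u v : L2) : L2dot (- u) v = - L2dot u v.
Proof.
have h0 : L2dot 0 v = 0.
  by apply: (addrI (L2dot 0 v)); rewrite -L2dotDl !addr0.
by apply/eqP; rewrite -addr_eq0 -L2dotDl addNr h0.
Qed.

Lemma L2norm_sqrB (u v : L2) : L2norm (u - v) ^+ 2 =
  L2norm u ^+ 2 - complex.Re (L2dot u v) *+ 2 + L2norm v ^+ 2.
Proof.
rewrite !L2norm_sqr L2dotDl L2dotNl (L2dotC (u - v)) (L2dotC (u - v) v).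
rewrite !L2dotDl !L2dotNl (L2dotC v u).
case: (L2dot v v) (L2dotC v v) => a b /= _.
case: (L2dot u u) (L2dot v u) => [s t] [x y] /=.
ring.
Qed.
End L2fun.

Section Spectral.
Context {d : measure_display} {T : measurableType d} {R : realType}.
Variable mu : {measure set T -> \bar R}.

(* [P l] is the orthogonal projection onto the spectral subspace of ]-oo, l]. *)
Record resolution_of_identity := ResolutionOfIdentity {
  roi_proj :> R -> {linear L2 mu -> L2 mu};
  roi_selfadjoint : forall l u v,
    L2dot (roi_proj l u) v = L2dot u (roi_proj l v);
  roi_comp : forall a b u,
    roi_proj a (roi_proj b u) = roi_proj (Num.min a b) u;
  roi_right_continuous : forall l u,
    L2norm (roi_proj t u - roi_proj l u) @[t --> l^'+] --> (0 : R);
  roi_ninfty : forall u, L2norm (roi_proj t u) @[t --> -oo] --> (0 : R);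
  roi_pinfty : forall u, L2norm (roi_proj t u - u) @[t --> +oo] --> (0 : R)
}.

Variable P : resolution_of_identity.

Definition spectral_cdf (u : L2 mu) (l : R) : R := L2norm (P l u) ^+ 2.

Lemma spectral_cdfB (u : L2 mu) (a b : R) : a <= b ->
  L2norm (P b u - P a u) ^+ 2 = spectral_cdf u b - spectral_cdf u a.
Proof.
move=> ab; rewrite L2norm_sqrB roi_selfadjoint roi_comp (min_r ab).
have -> : L2dot u (P a u) = L2dot (P a u) (P a u).
  by rewrite roi_selfadjoint roi_comp minxx.
by rewrite -L2norm_sqr /spectral_cdf mulr2n opprD addrA addrNK.
Qed.

Section cumulative.
Variable u : L2 mu.

Let spectral_cdf_nd : nondecreasing (spectral_cdf u).
Proof. by move=> a b ab; rewrite -subr_ge0 -spectral_cdfB// sqr_ge0. Qed.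

Let spectral_cdf_rc : right_continuous (spectral_cdf u).
Proof.
move=> l; have c := @roi_right_continuous P l u.
have h : (spectral_cdf u l + L2norm (P t u - P l u) * L2norm (P t u - P l u))
    @[t --> l^'+] --> spectral_cdf u l.
  rewrite -[X in _ --> X]addr0 -[X in _ --> _ + X](mulr0 0).
  by apply: cvgD; [exact: cvg_cst|exact: cvgM].
apply: cvg_trans h; apply: near_eq_cvg.
apply: filterS (nbhs_right_ge l) => t lt.
by rewrite -expr2 spectral_cdfB// addrC subrK.
Qed.

HB.instance Definition _ :=
  isCumulative.Build R _ R (spectral_cdf u) spectral_cdf_nd spectral_cdf_rc.
End cumulative.

(* The Stieltjes measure d(||P(l)u||^2). *)
Definition spectral_measure (u : L2 mu) :=
  lebesgue_stieltjes_measure (spectral_cdf u : cumulative R R).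

(* A list [s] of pairs (b, c) encodes the step function l |-> sum of
   c * 1_(]-oo, b])(l), whose integral against dP(l)u is the sum of c P(b)u. *)
Definition step_fun (s : seq (R * R[i])) (l : R) : R[i] :=
  \sum_(j <- s) (if l <= j.1 then j.2 else 0).

Definition step_integral (s : seq (R * R[i])) (u : L2 mu) : L2 mu :=
  \sum_(j <- s) j.2 *: P j.1 u.

(* [spectral_integral f u w]: the vector integral of f(l) dP(l)u over the real
   line is defined and equals w.  It extends the integral of step functions
   along the isometry || \int s dP u || = || s ||_{L^2(d||P(l)u||^2)}, so its
   domain is { u | \int |f|^2 d||P(l)u||^2 < +oo }. *)
Definition spectral_integral (f : R -> R[i]) (u w : L2 mu) : Prop :=
  [/\ measurable_fun setT (Rep f), measurable_fun setT (Imp f) &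
    forall e : R, 0 < e -> exists s : seq (R * R[i]),
      (\int[spectral_measure u]_l (Normc.normc (f l - step_fun s l) ^+ 2)%:E
         <= e%:E)%E
      /\ L2norm (step_integral s u - w) <= e].

(* Partially defined operators are represented by their graphs. *)
Definition op_comp (A B : L2 mu -> L2 mu -> Prop) (u w : L2 mu) : Prop :=
  exists v, B u v /\ A v w.

End Spectral.

Section Operators.
Context {d : measure_display} {T : measurableType d} {R : realType}.
Variable mu : {measure set T -> \bar R}.

(* [op_fun] is only meaningful on [op_dom]. *)
Record unbounded_operator := UnboundedOperator {
  op_dom : set (L2 mu);
  op_fun : L2 mu -> L2 mu;
  op_dom0 : op_dom 0;
  op_dom_linear : forall a u v, op_dom u -> op_dom v -> op_dom (a *: u + v);
  op_fun_linear : forall a u v, op_dom u -> op_dom v ->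
    op_fun (a *: u + v) = a *: op_fun u + op_fun v
}.

Definition densely_defined (A : unbounded_operator) : Prop :=
  forall (v : L2 mu) (e : R), 0 < e ->
    exists2 u, op_dom A u & L2norm (u - v) < e.

Definition self_adjoint (A : unbounded_operator) : Prop :=
  densely_defined A /\
  forall v z, (forall u, op_dom A u -> L2dot (op_fun A u) v = L2dot u z) <->
              (op_dom A v /\ op_fun A v = z).

Definition non_positive (A : unbounded_operator) : Prop :=
  forall u, op_dom A u -> L2dot (op_fun A u) u <= 0.

(* [- Delta] is the integral of l dP(l), as unbounded operators. *)
Definition spectral_resolution_opp
    (Delta : unbounded_operator) (P : resolution_of_identity mu) : Prop :=
  forall u w, spectral_integral P (fun l => l%:C) u w <->
              (op_dom Delta u /\ w = - op_fun Delta u).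

Variable P : resolution_of_identity mu.

(* exp(t Delta) *)
Definition heat_operator (t : R) : L2 mu -> L2 mu -> Prop :=
  spectral_integral P (fun l => (expR (- (t * l)))%:C).

(* (I - Delta)^s *)
Definition bessel_operator (s : R) : L2 mu -> L2 mu -> Prop :=
  spectral_integral P (fun l => ((1 + l) `^ s)%:C).

(* The integral of p dP over (0, +oo); values of [p] on (-oo, 0] are ignored. *)
Definition positive_calculus (p : R -> R[i]) : L2 mu -> L2 mu -> Prop :=
  spectral_integral P (fun l => if 0 < l then p l else 0).

(* p(-Delta) for a symbol [p] of order [m]. *)
Definition symbol_operator (dim m : R) (p : R -> R[i]) :
    L2 mu -> L2 mu -> Prop :=
  if 0 < m then
    op_comp (bessel_operator (m / (dim + 1)))
      (positive_calculus
         (fun l => ((1 + l) `^ (- (m / (dim + 1))))%:C * p l))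
  else positive_calculus p.

End Operators.

Section Symbols.
Context {R : realType}.

(* Functions on (0, +oo) are represented by functions on the real line whose
   values on (-oo, 0] are irrelevant. *)
Definition smooth_pos (p : R -> R[i]) : Prop :=
  forall (k : nat) (l : R), 0 < l ->
    derivable (derive1n k (Rep p)) l 1 /\ derivable (derive1n k (Imp p)) l 1.

(* The Euler operator l d/dl, on real and imaginary parts. *)
Definition euler (p : R -> R[i]) (l : R) : R[i] :=
  l%:C * (derive1 (Rep p) l +i* derive1 (Imp p) l).

Definition symbol (dim m : R) : set (R -> R[i]) :=
  [set p | smooth_pos p /\
    forall k : nat, exists2 C : R, 0 < C & forall l : R, 0 < l ->
      Normc.normc (iter k euler p l) <= C * (1 + l) `^ (m / (dim + 1))].

End Symbols.

#[short(type="pointedMetricType")]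
HB.structure Definition PointedMetric (R : numDomainType) :=
  { X of Metric R X & PseudoPointedMetric R X }.

Notation borel X := (g_sigma_algebraType (@open X)).

Section Heat.
Context {R : realType} {X : pointedMetricType R}.
Variable mu : {measure set (borel X) -> \bar R}.

Definition doubling : Prop :=
  exists2 C : R, 0 < C & forall (x : X) (r : R), 0 < r ->
    (mu (ball x (2 * r)) <= C%:E * mu (ball x r))%E.

(* [h] extends the kernel of exp(t Delta), t > 0, to the right half-plane. *)
Record heat_kernel (P : resolution_of_identity mu)
    (dim gamma c1 c2 : R) (h : R[i] -> X -> X -> R[i]) : Prop := HeatKernel {
  hk_kernel : forall (t : R) (u w : L2 mu), 0 < t -> heat_operator P t u w ->
    \forall x \ae mu,
      cintegrable mu (fun y => h t%:C x y * u y) /\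
      w x = cintegral mu (fun y => h t%:C x y * u y);
  hk_positive : forall (t : R) (x y : X), 0 < t -> 0 < h t%:C x y;
  hk_bound : forall (t : R) (x y : X), 0 < t ->
    h t%:C x y <=
      (c1 * t `^ (- (dim / (dim + 1)))
       * expR (- (c2 * (mdist x y `^ (dim + 1) / t) `^ gamma)))%:C;
  hk_holomorphic : forall (x y : X) (z : R[i]), 0 < complex.Re z ->
    derivable ((fun z' => h z' x y) : (R[i])^o -> (R[i])^o) z 1
}.

End Heat.

(* Main.v *)
Require Import Defs.
From HB Require Import structures.
From mathcomp Require Import all_boot all_order all_algebra.
From mathcomp Require Import all_classical all_reals all_analysis.
From mathcomp Require Import measurable_realfun.
From mathcomp Require Import ring lra.
From mathcomp.real_closed Require Import complex.
Import Order.TTheory GRing.Theory Num.Theory.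
Import numFieldNormedType.Exports.
Local Open Scope classical_set_scope.
Local Open Scope ring_scope.
Local Open Scope complex_scope.

(** Two facts are established, and they are independent of each other.

    Symbols.  The Euler operator D = l d/dl satisfies the Leibniz rule
    D (p q) = D p * q + p * D q, and D p is again a symbol of the order of p.
    Hence D^k (p q) is a sum of products of a symbol of order m1 and a symbol
    of order m2, and (1 + l)^a (1 + l)^b = (1 + l)^(a + b) gives [symbolM].

    Operators.  A symbol operator is built from spectral integrals: one of them
    when m <= 0, and when m > 0 the composition of (I - Delta)^(m / (d + 1))
    with the integral of (1 + l)^(- m / (d + 1)) p(l).  The identity follows
    from two properties of the graphs of spectral integrals:
    - if g(P) u = v and f(P) v = w, then (f g)(P) u = w
      ([spectral_integral_comp]);
    - f(P) u is determined by f and u ([spectral_integral_unique]).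
    By the first one the two Bessel powers cancel, so that every symbol operator
    is contained in the spectral integral of the function equal to p on
    (0, +oo) and to 0 elsewhere; by the first one again, the left-hand side of
    the identity is contained in the spectral integral of p1 p2; by the second
    one, both sides agree wherever they are defined.

    Both properties come from the isometry
      ||f(P) u||^2 = integral of |f|^2 with respect to mu_u,
    where mu_u is the measure d||P(l) u||^2.  For step functions it is a
    computation with the relations P_a P_b = P_min(a,b) ([sqint_step_fun]), and
    it passes to the limit ([spectral_integral_sqint]).
    Applied to f - f = 0, it gives uniqueness.  Applied to g cut off at b, it
    gives ||P_b v||^2 = integral of |g|^2 over ]-oo, b] with respect to mu_u,
    when v = g(P) u; in other words mu_v has density |g|^2 with respect to mu_u
    ([spectral_measure_density]).  The composition rule follows: if a step
    function s is close to f in L^2(mu_v), then s g is close to f g in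
    L^2(mu_u); moreover s(P) is a bounded operator and s(P) v = (s g)(P) u
    ([spectral_integral_step]), so s g is in turn approximated in L^2(mu_u) by
    step functions whose integrals are close to s(P) v, hence to w. *)

Set Implicit Arguments.
Unset Strict Implicit.

(** * Moduli of complex numbers and a limiting argument *)

Section Normc.
Context {R : realType}.
Implicit Types a b : R[i].

Lemma normc_sqr a : Normc.normc a ^+ 2 = complex.Re a ^+ 2 + complex.Im a ^+ 2.
Proof. by case: a => x y; rewrite sqr_sqrtr//= addr_ge0// sqr_ge0. Qed.

Lemma normc_ge0 a : 0 <= Normc.normc a.
Proof. by case: a => x y; exact: sqrtr_ge0. Qed.

Lemma normcD_le a b :
  Normc.normc (a + b) <= Normc.normc a + Normc.normc b.
Proof.
have := ler_normD a b; rewrite !normc_def.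
case: a b => [a b] [s t] /=.
by rewrite -rmorphD /= lecR.
Qed.

(** A weighted form of the triangle inequality for squared moduli.  Unlike the
    triangle inequality itself, it is linear in the squares, so it can be
    integrated. *)
Lemma normc_sqrD_le e a b : 0 < e ->
  Normc.normc (a + b) ^+ 2 <=
    (1 + e) * Normc.normc a ^+ 2 + (1 + e^-1) * Normc.normc b ^+ 2.
Proof.
move=> e0; rewrite !normc_sqr; case: a b => [a b] [s t] /=.
have h (x y : R) : (x + y) ^+ 2 <= (1 + e) * x ^+ 2 + (1 + e^-1) * y ^+ 2.
  rewrite -subr_ge0.
  have -> : (1 + e) * x ^+ 2 + (1 + e^-1) * y ^+ 2 - (x + y) ^+ 2 =
      e^-1 * (e * x - y) ^+ 2 by field; rewrite gt_eqF.
  by rewrite mulr_ge0 ?sqr_ge0// invr_ge0 ltW.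
have := h a s; have := h b t; lra.
Qed.

End Normc.

(** This replaces the continuity of the norm in arguments with squared norms:
    [a] and [b] are squared norms, and [n] is the squared norm of an element
    within squared distance [z] of both of them; the two inequalities are then
    weighted triangle inequalities with weight [e].  One lets [z], then [e],
    tend to 0. *)
Lemma le_of_approx {R : realType} (a b : R) : 0 <= b ->
  (forall e z, 0 < e -> 0 < z -> exists n,
     a <= (1 + e) * n + (1 + e^-1) * z /\ n <= (1 + e) * b + (1 + e^-1) * z) ->
  a <= b.
Proof.
move=> b0 h; apply/ler_addgt0Pr => c c0.
have b1 : 0 < b + 1 by lra.
(* (1 + e)^2 b <= b + 3 e b when e <= 1, so that this [e] costs at most c / 2;
   the value of z chosen below costs the other half. *)
pose e := Num.min 1 (c / (6 * (b + 1))).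
have e0 : 0 < e by rewrite lt_min ltr01 divr_gt0// mulr_gt0.
have e1 : e <= 1 by rewrite ge_min lexx.
have eb : 6 * (e * (b + 1)) <= c.
  have : e <= c / (6 * (b + 1)) by rewrite ge_min lexx orbT.
  rewrite ler_pdivlMr ?mulr_gt0//; lra.
have i0 : 0 < e^-1 by rewrite invr_gt0.
pose K := (2 + e) * (1 + e^-1).
have K0 : 0 < K by apply: mulr_gt0; lra.
have z0 : 0 < c / 2 / K by rewrite divr_gt0// divr_gt0.
have [n [h1 h2]] := h e _ e0 z0; set z := c / 2 / K in h1 h2 z0.
have Kz : K * z = c / 2 by rewrite /z mulrC divfK// gt_eqF.
have h3 : (1 + e) * n <= (1 + e) * ((1 + e) * b + (1 + e^-1) * z).
  by rewrite ler_pM2l//; lra.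
have h4 : a <= (1 + e) ^+ 2 * b + K * z by rewrite /K; lra.
have h5 : e * e * b <= e * b by rewrite -mulrA ler_piMl// mulr_ge0// ltW.
rewrite Kz in h4; have : 0 <= e * b by rewrite mulr_ge0// ltW.
nra.
Qed.


(** * Smooth functions on the half-line and products of symbols *)

Section Smooth.
Context {R : realType}.
Implicit Types (f g : R -> R) (l : R).

(** Finite orders of differentiability are what the induction for products
    needs: the derivative of a product is a sum of products of functions of
    which one has lost one order. *)
Definition derivable_upto n f :=
  forall k l, (k <= n)%N -> 0 < l -> derivable (derive1n k f) l 1.

Lemma derive1D_at f g l : derivable f l 1 -> derivable g l 1 ->
  (f \+ g)^`()%classic l = f^`()%classic l + g^`()%classic l.
Proof. by move=> df dg; rewrite !derive1E deriveD. Qed.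

Lemma derive1B_at f g l : derivable f l 1 -> derivable g l 1 ->
  (f \- g)^`()%classic l = f^`()%classic l - g^`()%classic l.
Proof. by move=> df dg; rewrite !derive1E deriveB. Qed.

Lemma derive1M_at f g l : derivable f l 1 -> derivable g l 1 ->
  (f \* g)^`()%classic l = f l * g^`()%classic l + g l * f^`()%classic l.
Proof. by move=> df dg; rewrite !derive1E deriveM. Qed.

(** Equality on (0, +oo) is equality near each point of this open set, so
    derivatives at positive points only depend on the restriction of a function
    to (0, +oo). *)
Lemma eq_pos_near f g l : (forall x, 0 < x -> f x = g x) -> 0 < l ->
  \forall x \near l, f x = g x.
Proof. by move=> fg l0; apply: filterS (lt_nbhsr l0) => x; exact: fg. Qed.

Lemma eq_pos_derive1 f g l : (forall x, 0 < x -> f x = g x) -> 0 < l ->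
  f^`()%classic l = g^`()%classic l.
Proof.
by move=> fg l0; rewrite !derive1E; apply: near_eq_derive; exact: eq_pos_near.
Qed.

Lemma eq_pos_derive1n f g k : (forall x, 0 < x -> f x = g x) ->
  forall x, 0 < x -> derive1n k f x = derive1n k g x.
Proof.
move=> fg; elim: k => [|k IH] x x0; first by rewrite !derive1n0 fg.
by rewrite !derive1nS; exact: eq_pos_derive1.
Qed.

Lemma eq_pos_derivable_upto n f g : (forall x, 0 < x -> f x = g x) ->
  derivable_upto n f -> derivable_upto n g.
Proof.
move=> fg sf k l kn l0; apply: near_eq_derivable (sf k l kn l0).
by apply: eq_pos_near => //; exact: eq_pos_derive1n.
Qed.

Lemma derivable_upto_derivable n f l :
  derivable_upto n f -> 0 < l -> derivable f l 1.
Proof. by move=> sf l0; have := sf 0%N l (leq0n n) l0; rewrite derive1n0. Qed.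

Lemma derivable_uptoS n f :
  derivable_upto n.+1 f <->
  (forall l, 0 < l -> derivable f l 1) /\ derivable_upto n f^`()%classic.
Proof.
split=> [sf|[f0 sf] [|k] l kn l0].
- split=> [l l0|k l kn l0]; first exact: derivable_upto_derivable sf l0.
  by rewrite -derive1Sn; exact: sf.
- by rewrite derive1n0; exact: f0.
- by rewrite derive1Sn; exact: sf.
Qed.

Lemma derivable_uptoW n f : derivable_upto n.+1 f -> derivable_upto n f.
Proof. by move=> sf k l kn; apply: sf; exact: leqW. Qed.

Lemma derivable_uptoD n f g :
  derivable_upto n f -> derivable_upto n g -> derivable_upto n (f \+ g).
Proof.
elim: n f g => [|n IH] f g sf sg.
  move=> [|//] l _ l0; rewrite derive1n0.
  by apply: derivableD; [exact: derivable_upto_derivable sf l0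
                        |exact: derivable_upto_derivable sg l0].
have /derivable_uptoS[df sf'] := sf; have /derivable_uptoS[dg sg'] := sg.
apply/derivable_uptoS; split=> [l l0|].
  by apply: derivableD; [exact: df|exact: dg].
apply: eq_pos_derivable_upto (IH _ _ sf' sg') => x x0 /=.
by rewrite derive1D_at//; [exact: df|exact: dg].
Qed.

Lemma derivable_uptoM n f g :
  derivable_upto n f -> derivable_upto n g -> derivable_upto n (f \* g).
Proof.
elim: n f g => [|n IH] f g sf sg.
  move=> [|//] l _ l0; rewrite derive1n0.
  by apply: derivableM; [exact: derivable_upto_derivable sf l0
                        |exact: derivable_upto_derivable sg l0].
have /derivable_uptoS[df sf'] := sf; have /derivable_uptoS[dg sg'] := sg.
apply/derivable_uptoS; split=> [l l0|].
  by apply: derivableM; [exact: df|exact: dg].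
apply: eq_pos_derivable_upto (derivable_uptoD (IH _ _ (derivable_uptoW sf) sg')
   (IH _ _ (derivable_uptoW sg) sf')) => x x0 /=.
by rewrite derive1M_at//; [exact: df|exact: dg].
Qed.

Lemma derivable_upto_cst n (c : R) : derivable_upto n (cst c).
Proof.
elim: n c => [|n IH] c; first by move=> [|//] l _ _; rewrite derive1n0.
apply/derivable_uptoS; split=> //.
by apply: eq_pos_derivable_upto (IH 0) => x _; rewrite derive1_cst.
Qed.

Lemma derivable_upto_id n : derivable_upto n (@id R).
Proof.
case: n => [|n]; first by move=> [|//] l _ _; rewrite derive1n0.
apply/derivable_uptoS; split=> [l _|]; first exact: derivable_id.
move: (@derivable_upto_cst n 1); apply: eq_pos_derivable_upto => x _.
by rewrite derive1E derive_id.
Qed.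

End Smooth.

Section ComplexSmooth.
Context {R : realType}.
Implicit Types (p q : R -> R[i]) (l : R).

Lemma smooth_posP p : smooth_pos p <->
  forall n, derivable_upto n (Rep p) /\ derivable_upto n (Imp p).
Proof.
split=> [sp n|sp k l l0].
  by split=> k l _ l0; have [] := sp k l l0.
by have [re im] := sp k; split; [exact: re|exact: im].
Qed.

Lemma smooth_pos_derivable p l : smooth_pos p -> 0 < l ->
  derivable (Rep p) l 1 /\ derivable (Imp p) l 1.
Proof. by move=> sp l0; have := sp 0%N l l0; rewrite !derive1n0. Qed.

Lemma smooth_posM p q : smooth_pos p -> smooth_pos q ->
  smooth_pos (fun l => p l * q l).
Proof.
move=> /smooth_posP sp /smooth_posP sq; apply/smooth_posP => n.
have [rp ip] := sp n; have [rq iq] := sq n; split.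
- apply: eq_pos_derivable_upto (derivable_uptoD (derivable_uptoM rp rq)
    (derivable_uptoM (@derivable_upto_cst _ n (-1)) (derivable_uptoM ip iq))).
  by move=> x _ /=; case: (p x) (q x) => [a b] [s t] /=; rewrite mulN1r.
- apply: eq_pos_derivable_upto
    (derivable_uptoD (derivable_uptoM rp iq) (derivable_uptoM ip rq)).
  by move=> x _ /=; case: (p x) (q x) => [a b] [s t] /=.
Qed.

Lemma smooth_pos_euler p : smooth_pos p -> smooth_pos (euler p).
Proof.
move=> /smooth_posP sp; apply/smooth_posP => n.
have [/derivable_uptoS[_ rp] /derivable_uptoS[_ ip]] := sp n.+1; split.
- apply: eq_pos_derivable_upto (derivable_uptoM (@derivable_upto_id _ n) rp).
  by move=> x _ /=; rewrite mul0r subr0.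
- apply: eq_pos_derivable_upto (derivable_uptoM (@derivable_upto_id _ n) ip).
  by move=> x _ /=; rewrite mul0r addr0.
Qed.

Lemma smooth_pos_iter_euler k p : smooth_pos p -> smooth_pos (iter k euler p).
Proof.
by move=> sp; elim: k => [//|k IH]; rewrite iterS; exact: smooth_pos_euler.
Qed.

Lemma eq_pos_iter_euler k p q : (forall l, 0 < l -> p l = q l) ->
  forall l, 0 < l -> iter k euler p l = iter k euler q l.
Proof.
move=> pq; elim: k => [//|k IH] l l0; rewrite !iterS /euler.
by congr (_ * (_ +i* _)); apply: eq_pos_derive1 => // x x0 /=; rewrite IH.
Qed.

Lemma eulerD p q l : smooth_pos p -> smooth_pos q -> 0 < l ->
  euler (fun x => p x + q x) l = euler p l + euler q l.
Proof.
move=> sp sq l0; rewrite /euler -mulrDr; congr (_ * _).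
have [rp ip] := smooth_pos_derivable sp l0.
have [rq iq] := smooth_pos_derivable sq l0.
have -> : Rep (fun x => p x + q x) = Rep p \+ Rep q.
  by apply/funext => x /=; case: (p x) (q x) => [a b] [s t].
have -> : Imp (fun x => p x + q x) = Imp p \+ Imp q.
  by apply/funext => x /=; case: (p x) (q x) => [a b] [s t].
by rewrite (derive1D_at rp rq) (derive1D_at ip iq).
Qed.

Lemma eulerM p q l : smooth_pos p -> smooth_pos q -> 0 < l ->
  euler (fun x => p x * q x) l = euler p l * q l + p l * euler q l.
Proof.
move=> sp sq l0; rewrite /euler mulrCA -!mulrA -mulrDr; congr (_ * _).
have [rp ip] := smooth_pos_derivable sp l0.
have [rq iq] := smooth_pos_derivable sq l0.
have -> : Rep (fun x => p x * q x) = (Rep p \* Rep q) \- (Imp p \* Imp q).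
  by apply/funext => x /=; case: (p x) (q x) => [a b] [s t].
have -> : Imp (fun x => p x * q x) = (Rep p \* Imp q) \+ (Imp p \* Rep q).
  by apply/funext => x /=; case: (p x) (q x) => [a b] [s t].
rewrite (derive1B_at (derivableM rp rq) (derivableM ip iq)).
rewrite (derive1D_at (derivableM rp iq) (derivableM ip rq)).
rewrite (derive1M_at rp rq) (derive1M_at ip iq) (derive1M_at rp iq).
rewrite (derive1M_at ip rq).
move: (derive1 _ _) (derive1 _ _) (derive1 _ _) (derive1 _ _) => p1 q1 p2 q2.
case: (p l) (q l) => [a b] [s t].
by apply/eqP; rewrite eq_complex /=; apply/andP; split; apply/eqP; ring.
Qed.

Lemma iter_eulerD k p q l : smooth_pos p -> smooth_pos q -> 0 < l ->
  iter k euler (fun x => p x + q x) l = iter k euler p l + iter k euler q l.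
Proof.
move=> sp sq; elim: k l => [//|k IH] l l0; rewrite !iterS.
rewrite -(eulerD (smooth_pos_iter_euler k sp) (smooth_pos_iter_euler k sq) l0).
by apply: (@eq_pos_iter_euler 1%N) => // x x0; exact: IH.
Qed.

(** The operator l d/dl is a derivation and maps symbols of order m to symbols
    of order m.  Peeling off one derivative at a time,
    D^(k+1) (p q) = D^k (D p * q) + D^k (p * D q), thus yields the bounds by
    induction on k, for all pairs of symbols simultaneously. *)
Lemma symbolM (d m1 m2 : R) p q : symbol d m1 p -> symbol d m2 q ->
  symbol d (m1 + m2) (fun l => p l * q l).
Proof.
move=> [sp bp] [sq bq]; split; first exact: smooth_posM.
move=> k; elim: k p q sp sq bp bq => [|k IH] p q sp sq bp bq.
  have [C1 C10 h1] := bp 0%N; have [C2 C20 h2] := bq 0%N.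
  exists (C1 * C2); first exact: mulr_gt0.
  move=> l l0 /=; rewrite Normc.normcM.
  rewrite (mulrDl m1) powRD; last first.
    by apply/implyP => _; rewrite gt_eqF// addr_gt0.
  by rewrite mulrACA; apply: ler_pM;
    [exact: normc_ge0|exact: normc_ge0|exact: h1|exact: h2].
have bS (r : R -> R[i]) m : (forall k, exists2 C : R, 0 < C & forall l : R, 0 < l ->
      Normc.normc (iter k euler r l) <= C * (1 + l) `^ (m / (d + 1))) ->
    forall k, exists2 C : R, 0 < C & forall l : R, 0 < l ->
      Normc.normc (iter k euler (euler r) l) <= C * (1 + l) `^ (m / (d + 1)).
  by move=> br j; have := br j.+1; rewrite iterSr.
have [C1 C10 h1] := IH _ _ (smooth_pos_euler sp) sq (bS _ _ bp) bq.
have [C2 C20 h2] := IH _ _ sp (smooth_pos_euler sq) bp (bS _ _ bq).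
exists (C1 + C2); first exact: addr_gt0.
move=> l l0; rewrite iterSr.
rewrite (eq_pos_iter_euler k (fun x => eulerM sp sq (l := x)))//.
rewrite (iter_eulerD _ (smooth_posM (smooth_pos_euler sp) sq)
  (smooth_posM sp (smooth_pos_euler sq)) l0).
apply: le_trans (normcD_le _ _) _; rewrite mulrDl.
by apply: lerD; [exact: h1|exact: h2].
Qed.

End ComplexSmooth.

(** * The Hilbert space of square integrable functions *)

Section L2.
Context {d : measure_display} {T : measurableType d} {R : realType}.
Variable mu : {measure set T -> \bar R}.
Implicit Types (u v w : L2 mu) (a : R[i]).

Lemma L2dotZl a u w : L2dot (a *: u) w = a * L2dot u w.
Proof.
have [i1 i2] := L2_dot_integrable u w.
have [k1 k2] := L2_dot_integrable (a *: u) w.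
have iZ (c : R) (f : T -> R) : mu.-integrable setT (EFin \o f) ->
    mu.-integrable setT (EFin \o (fun x => c * f x)).
  by move=> fi; exact: (integrableZl measurableT c fi).
rewrite /L2dot /cintegral.
transitivity ((\int[mu]_x (complex.Re a * complex.Re (u x * (w x)^*)
     - complex.Im a * complex.Im (u x * (w x)^*)))
  +i* (\int[mu]_x (complex.Re a * complex.Im (u x * (w x)^*)
     + complex.Im a * complex.Re (u x * (w x)^*)))).
  congr (_ +i* _); congr fine; apply: ae_eq_integral => //.
  - exact: measurable_int k1.
  - exact: measurable_int (integrableB _ (iZ _ _ i1) (iZ _ _ i2)).
  - apply: filterS (L2scaleE a u) => x -> _ /=; congr (_%:E).
    by rewrite -mulrA; case: (a) (u x * _) => [? ?] [? ?].
  - exact: measurable_int k2.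
  - exact: measurable_int (integrableD _ (iZ _ _ i2) (iZ _ _ i1)).
  - apply: filterS (L2scaleE a u) => x -> _ /=; congr (_%:E).
    by rewrite -mulrA; case: (a) (u x * _) => [? ?] [? ?].
rewrite RintegralB//; [|exact: iZ..]; rewrite RintegralD//; [|exact: iZ..].
by clear k1 k2; rewrite !RintegralZl//; case: a.
Qed.

Lemma L2dot0l w : L2dot 0 w = 0.
Proof. by rewrite -(scale0r (0 : L2 mu)) L2dotZl mul0r. Qed.

Lemma L2dot0r w : L2dot w 0 = 0.
Proof. by rewrite L2dotC L2dot0l conjc0. Qed.

Lemma L2dotDr u v w : L2dot w (u + v) = L2dot w u + L2dot w v.
Proof. by rewrite (L2dotC (u + v) w) (L2dotC u w) (L2dotC v w) L2dotDl rmorphD. Qed.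

Lemma L2dotZr a u w : L2dot w (a *: u) = a^* * L2dot w u.
Proof. by rewrite (L2dotC (a *: u) w) (L2dotC u w) L2dotZl rmorphM. Qed.

Lemma L2norm_ge0 u : 0 <= L2norm u.
Proof. exact: sqrtr_ge0. Qed.

Lemma L2norm_sqrZ a u : L2norm (a *: u) ^+ 2 = Normc.normc a ^+ 2 * L2norm u ^+ 2.
Proof.
rewrite !L2norm_sqr L2dotZl L2dotZr normc_sqr.
have : complex.Im (L2dot u u) = 0.
  have /(congr1 (@complex.Im _)) := L2dotC u u.
  by case: (L2dot u u) => ? y /= h; lra.
by case: a (L2dot u u) => [? ?] [? y] /= ->; ring.
Qed.

Lemma L2normN u : L2norm (- u) = L2norm u.
Proof.
apply/eqP; rewrite -(@eqrXn2 _ 2)//; [|exact: L2norm_ge0..].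
by rewrite -scaleN1r L2norm_sqrZ normc_sqr/= oppr0 expr0n/= addr0 sqrrN expr1n mul1r.
Qed.

(** Expansion of 0 <= ||e u - v||^2. *)
Lemma L2norm_sqrD_le e u v : 0 < e ->
  L2norm (u + v) ^+ 2 <= (1 + e) * L2norm u ^+ 2 + (1 + e^-1) * L2norm v ^+ 2.
Proof.
move=> e0; have := L2norm_sqrB u (- v); rewrite opprK L2normN => ->.
have := sqr_ge0 (L2norm ((- e)%:C *: u - (- v))).
rewrite L2norm_sqrB L2norm_sqrZ normc_sqr L2dotZl L2normN.
set x := L2norm u ^+ 2; set y := L2norm v ^+ 2; case: (L2dot u (- v)) => z t /=.
rewrite expr0n /= addr0 mul0r subr0 -[X in _ - X]mulr_natl => h.
rewrite -(ler_pM2l e0) -subr_ge0; apply: le_trans h _; rewrite le_eqVlt.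
by apply/orP; left; apply/eqP; field; rewrite gt_eqF.
Qed.

Lemma L2norm_eq0 u : L2norm u = 0 -> u = 0.
Proof.
move=> /(congr1 (fun x => x ^+ 2)); rewrite L2norm_sqr expr0n /L2dot /= => h.
have [i1 _] := L2_dot_integrable u u.
have ge0 x : 0 <= complex.Re (u x * (u x)^*).
  by case: (u x) => a b /=; rewrite mulrN opprK addr_ge0// -expr2 sqr_ge0.
have : (\int[mu]_x `|(complex.Re (u x * (u x)^*))%:E| = 0)%E.
  rewrite -(@fineK _ (integral _ _ _)).
    congr (_%:E); apply: etrans h; congr fine; apply: eq_integral => x _.
    by rewrite gee0_abs// lee_fin.
  by apply: integrable_fin_num => //; exact: (integrable_abse i1).
move/(ae_eq_integral_abs mu measurableT (measurable_int _ i1)) => ae0.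
apply/L2P; have zeroE : \forall x \ae mu, (0 : L2 mu) x = 0.
  by apply: filterS (L2scaleE 0 (0 : L2 mu)) => x; rewrite scale0r mul0r.
apply: filterS2 zeroE ae0 => x -> /(_ I) /= [].
case: (u x) => a b /=; rewrite mulrN opprK => /eqP.
rewrite -!expr2 paddr_eq0 ?sqr_ge0// !sqrf_eq0 => /andP[/eqP-> /eqP->].
by [].
Qed.

End L2.

(** * Measures with a density and square integrals *)

Section Density.
Context {d : measure_display} {T : measurableType d} {R : realType}.
Variable mu : {measure set T -> \bar R}.
Variable f : T -> R.
Hypothesis mf : measurable_fun setT f.
Hypothesis f0 : forall x, 0 <= f x.

(** The two unnamed hypotheses are parameters, so that the measure structure
    below can be attached to the function. *)
Definition density (_ : measurable_fun setT f) (_ : forall x, 0 <= f x)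
  (A : set T) : \bar R := (\int[mu]_(x in A) (f x)%:E)%E.

Local Open Scope ereal_scope.

Let mfE : measurable_fun setT (EFin \o f).
Proof. exact/measurable_EFinP. Qed.

Let f0E x : 0 <= (f x)%:E.
Proof. by rewrite lee_fin. Qed.

Let density0 : density mf f0 set0 = 0.
Proof. exact: integral_set0. Qed.

Let density_ge0 A : 0 <= density mf f0 A.
Proof. by apply: integral_ge0 => x _. Qed.

Let density_sigma_additive : semi_sigma_additive (density mf f0).
Proof. exact: semi_sigma_additive_nng_induced. Qed.

HB.instance Definition _ := isMeasure.Build _ _ _ (density mf f0)
  density0 density_ge0 density_sigma_additive.

Import HBNNSimple.

(** By linearity it is enough to treat the indicators of the level sets of
    [h]. *)
Lemma integral_density_nnsfun (h : {nnsfun T >-> R}) :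
  \int[density mf f0]_x (h x)%:E = \int[mu]_x ((h x)%:E * (f x)%:E).
Proof.
have hE x : (h x)%:E = \sum_(y \in range h) (y * \1_(h @^-1` [set y]) x)%:E.
  by rewrite fsumEFin// -fimfunE.
have fin : finite_set (range h) by [].
transitivity (\sum_(y \in range h)
    \int[density mf f0]_x (y * \1_(h @^-1` [set y]) x)%:E).
  under eq_integral do rewrite hE.
  rewrite ge0_integral_fsum// => [y|y x _]; last exact: nnfun_muleindic_ge0.
  by apply/measurable_EFinP/measurable_funM.
transitivity (\sum_(y \in range h)
    \int[mu]_x ((y * \1_(h @^-1` [set y]) x)%:E * (f x)%:E)); last first.
  rewrite -ge0_integral_fsum//.
  - apply: eq_integral => x _; rewrite hE ge0_mule_fsuml// => y.
    exact: nnfun_muleindic_ge0.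
  - move=> y; apply: emeasurable_funM => //.
    by apply/measurable_EFinP/measurable_funM.
  - by move=> y x _; rewrite mule_ge0// nnfun_muleindic_ge0.
apply: eq_fsbigr => y; rewrite inE => -[x _ <-].
have mA : measurable (h @^-1` [set h x]) by [].
set A := h @^-1` [set h x] in mA *.
have mi : measurable_fun setT (fun z : T => (\1_A z : R)%:E).
  exact/measurable_EFinP.
have hx0 : 0 <= (h x)%:E by rewrite lee_fin.
transitivity ((h x)%:E * \int[density mf f0]_z (\1_A z)%:E).
  by rewrite -ge0_integralZl// => z _; rewrite lee_fin.
transitivity ((h x)%:E * \int[mu]_z ((\1_A z)%:E * (f z)%:E)); last first.
  rewrite -ge0_integralZl//.
  - by apply: eq_integral => z _; rewrite EFinM muleA.
  - exact: emeasurable_funM.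
  - by move=> z _; rewrite mule_ge0// lee_fin.
congr (_ * _); rewrite integral_indic// setIT /= /density.
rewrite integral_mkcond; apply: eq_integral => z _.
by rewrite patchE indicE; case: ifP => _; rewrite ?mul1e ?mul0e.
Qed.

(** Monotone convergence along an increasing sequence of simple functions. *)
Lemma integral_density (h : T -> \bar R) :
  measurable_fun setT h -> (forall x, 0 <= h x) ->
  \int[density mf f0]_x h x = \int[mu]_x (h x * (f x)%:E).
Proof.
move=> mh h0; pose k := nnsfun_approx measurableT mh.
have mk n : measurable_fun setT (fun x => (k n x)%:E).
  by apply/measurable_EFinP; exact: measurable_funPT.
have k0 n x : 0 <= (k n x)%:E by rewrite lee_fin.
have ndk x m n : (m <= n)%N -> (k m x)%:E <= (k n x)%:E.
  by move=> mn; rewrite lee_fin; exact/lefP/nd_nnsfun_approx.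
have ck x : (k n x)%:E @[n --> \oo] --> h x.
  by apply: cvg_nnsfun_approx => // y _; exact: h0.
transitivity (limn (fun n => \int[density mf f0]_x (k n x)%:E)).
  rewrite -monotone_convergence//; last by move=> x _ m n; exact: ndk.
  by apply: eq_integral => x _; apply/esym/cvg_lim => //; exact: ck.
under eq_fun do rewrite integral_density_nnsfun.
rewrite -monotone_convergence//.
- apply: eq_integral => x _; apply/cvg_lim => //; apply: cvgeZr => //.
- by move=> n; apply: emeasurable_funM.
- by move=> n x _; rewrite mule_ge0.
- by move=> x _ m n mn; rewrite lee_wpmul2r// ndk.
Qed.

End Density.

Section SquareIntegral.
Context {d : measure_display} {T : measurableType d} {R : realType}.
Implicit Types (f g : T -> R[i]).

Definition cmeasurable f :=
  measurable_fun setT (Rep f) /\ measurable_fun setT (Imp f).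

Lemma cmeasurableD f g : cmeasurable f -> cmeasurable g ->
  cmeasurable (fun x => f x + g x).
Proof.
move=> [fr fi] [gr gi]; split.
- rewrite [X in measurable_fun _ X](_ : _ = Rep f \+ Rep g).
    exact: measurable_funD.
  by apply/funext => x /=; case: (f x) (g x) => [? ?] [? ?].
- rewrite [X in measurable_fun _ X](_ : _ = Imp f \+ Imp g).
    exact: measurable_funD.
  by apply/funext => x /=; case: (f x) (g x) => [? ?] [? ?].
Qed.

Lemma cmeasurableM f g : cmeasurable f -> cmeasurable g ->
  cmeasurable (fun x => f x * g x).
Proof.
move=> [fr fi] [gr gi]; split.
- rewrite [X in measurable_fun _ X](_ : _ = (Rep f \* Rep g) \- (Imp f \* Imp g)).
    by apply: measurable_funB; exact: measurable_funM.
  by apply/funext => x /=; case: (f x) (g x) => [? ?] [? ?].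
- rewrite [X in measurable_fun _ X](_ : _ = (Rep f \* Imp g) \+ (Imp f \* Rep g)).
    by apply: measurable_funD; exact: measurable_funM.
  by apply/funext => x /=; case: (f x) (g x) => [? ?] [? ?].
Qed.

Lemma cmeasurable_cst (c : R[i]) : cmeasurable (fun=> c).
Proof. by split; exact: measurable_cst. Qed.

Lemma cmeasurableB f g : cmeasurable f -> cmeasurable g ->
  cmeasurable (fun x => f x - g x).
Proof.
move=> mf mg; rewrite (_ : (fun x => _) = (fun x => f x + (-1) * g x)).
  by apply: cmeasurableD => //; exact: cmeasurableM (cmeasurable_cst _) mg.
by apply/funext => x; rewrite mulN1r.
Qed.

Lemma measurable_normc_sqr f : cmeasurable f ->
  measurable_fun setT (fun x => Normc.normc (f x) ^+ 2).
Proof.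
move=> [fr fi]; rewrite [X in measurable_fun _ X](_ : _ =
  (fun x => complex.Re (f x) ^+ 2 + complex.Im (f x) ^+ 2)).
  by apply: measurable_funD; exact: measurable_funX.
by apply/funext => x; rewrite normc_sqr.
Qed.

Variable mu : {measure set T -> \bar R}.
Local Open Scope ereal_scope.

Definition sqint f := \int[mu]_x (Normc.normc (f x) ^+ 2)%:E.

Lemma sqint_ge0 f : 0 <= sqint f.
Proof. by apply: integral_ge0 => x _; rewrite lee_fin sqr_ge0. Qed.

Lemma sqintD_le (e : R) f g : (0 < e)%R -> cmeasurable f -> cmeasurable g ->
  sqint (fun x => f x + g x)%R <=
    (1 + e)%:E * sqint f + (1 + e^-1)%:E * sqint g.
Proof.
move=> e0 mf mg.
have e1 : (0 <= 1 + e)%R by rewrite addr_ge0// ltW.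
have e2 : (0 <= 1 + e^-1)%R by rewrite addr_ge0// invr_ge0 ltW.
have mE h : cmeasurable h ->
    measurable_fun setT (fun x => (Normc.normc (h x) ^+ 2)%:E).
  by move=> mh; apply/measurable_EFinP; exact: measurable_normc_sqr.
have sE h x : 0 <= (Normc.normc (h x : R[i]) ^+ 2)%:E.
  by rewrite lee_fin sqr_ge0.
rewrite /sqint -ge0_integralZl//; last exact: mE.
rewrite -ge0_integralZl//; last exact: mE.
rewrite -ge0_integralD//; last 4 first.
- by move=> x _; rewrite mule_ge0.
- by apply: emeasurable_funM => //; exact: mE.
- by move=> x _; rewrite mule_ge0.
- by apply: emeasurable_funM => //; exact: mE.
apply: ge0_le_integral => //.
- exact/mE/cmeasurableD.
- by apply: emeasurable_funD; apply: emeasurable_funM => //; exact: mE.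
- by move=> x _; rewrite -!EFinM -EFinD lee_fin normc_sqrD_le.
Qed.

Lemma sqint_le (K : R) f g : (0 <= K)%R -> cmeasurable f -> cmeasurable g ->
  (forall x, (Normc.normc (f x) ^+ 2 <= K * Normc.normc (g x) ^+ 2)%R) ->
  sqint f <= K%:E * sqint g.
Proof.
move=> K0 mf mg fg.
have mE h : cmeasurable h ->
    measurable_fun setT (fun x => (Normc.normc (h x) ^+ 2)%:E).
  by move=> mh; apply/measurable_EFinP; exact: measurable_normc_sqr.
rewrite /sqint -ge0_integralZl//; last 2 first.
- exact: mE.
- by move=> x _; rewrite lee_fin sqr_ge0.
apply: ge0_le_integral => //.
- by move=> x _; rewrite lee_fin sqr_ge0.
- exact: mE.
- by apply: emeasurable_funM => //; exact: mE.
- by move=> x _; rewrite -EFinM lee_fin.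
Qed.

End SquareIntegral.

(** * Spectral measures of half-lines and intervals *)

Section HalfLine.
Context {d : measure_display} {T : measurableType d} {R : realType}.
Variable mu : {measure set T -> \bar R}.
Variable P : resolution_of_identity mu.
Implicit Types (u v w : L2 mu) (s t : seq (R * R[i])) (f g : R -> R[i]).

Local Notation dP u := (spectral_measure P u).

Lemma spectral_measure_itvoc u (a b : R) : a <= b ->
  (dP u `]a, b]%classic = (spectral_cdf P u b - spectral_cdf P u a)%:E)%E.
Proof.
move=> ab; rewrite /spectral_measure /lebesgue_stieltjes_measure.
rewrite /measure_extension measurable_mu_extE/=; last exact: is_ocitv.
by rewrite wlength_itv_bnd.
Qed.

(** The half-line is the increasing union of the intervals ]b - n, b], and
    ||P(b - n) u|| tends to 0. *)
Lemma spectral_measure_half_line u (b : R) :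
  (dP u `]-oo, b]%classic = (spectral_cdf P u b)%:E)%E.
Proof.
pose F n := `](b - n%:R), b]%classic.
have Fcup : `]-oo, b]%classic = \bigcup_n F n.
  apply/seteqP; split=> x /=; rewrite in_itv/=.
    move=> xb; exists (Num.bound (b - x)) => //; rewrite /F/= in_itv/= xb andbT.
    have : b - x < (Num.bound (b - x))%:R.
      by apply: archi_boundP; rewrite subr_ge0.
    lra.
  by move=> [n _]; rewrite /F/= in_itv/= => /andP[].
have mF n : measurable (F n : set (measurableTypeR R)) by exact: measurable_itv.
have h : dP u (F n) @[n --> \oo] --> dP u `]-oo, b]%classic.
  rewrite Fcup; apply: nondecreasing_cvg_mu => //.
    exact: bigcup_measurable.
  move=> m n mn; apply/subsetPset => x; rewrite /F /= !in_itv/= => /andP[xm ->].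
  rewrite andbT; by apply: le_lt_trans xm; rewrite lerB// ler_nat.
have F0 : spectral_cdf P u (b - n%:R) @[n --> \oo] --> (0 : R).
  have c0 : spectral_cdf P u t @[t --> -oo] --> (0 : R).
    rewrite -[X in _ --> X](mul0r 0) /spectral_cdf.
    by under eq_fun do rewrite expr2; apply: cvgM; exact: roi_ninfty.
  apply: (cvg_comp _ _ _ c0); apply/cvgrNyPle => A.
  apply: filterS (nbhs_infty_ger (b - A)) => n; lra.
apply/esym; apply: cvg_unique h => //=.
under eq_fun do rewrite spectral_measure_itvoc ?lerBlDr ?lerDl//.
apply: cvg_EFin; first by near=> n.
rewrite -[X in _ --> X]subr0; apply: cvgB; [exact: cvg_cst|exact: F0].
Unshelve. all: end_near.
Qed.

(** The real counterpart of [step_fun], with the same encoding. *)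
Definition step_real (r : seq (R * R)) (l : R) : R :=
  \sum_(j <- r) (if l <= j.1 then j.2 else 0).

Lemma half_lineE (b c l : R) :
  (if l <= b then c else 0) = c * \1_(`]-oo, b]%classic) l.
Proof.
rewrite indicE; have -> : (l \in `]-oo, b]%classic) = (l <= b).
  by apply/idP/idP; rewrite ?inE /= ?in_itv.
by case: ifP => _; rewrite ?mulr1 ?mulr0.
Qed.

Lemma integral_step_real u (r : seq (R * R)) :
  (dP u).-integrable setT (EFin \o step_real r) /\
  (\int[dP u]_l (step_real r l)%:E =
    (\sum_(j <- r) j.2 * spectral_cdf P u j.1)%:E)%E.
Proof.
have mI (b : R) : measurable (`]-oo, b]%classic : set (measurableTypeR R)).
  exact: measurable_itv.
have i1 (b : R) : (dP u).-integrable setT (EFin \o \1_(`]-oo, b]%classic)).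
  apply/integrableP; split; first exact/measurable_EFinP.
  rewrite (eq_integral (fun l : measurableTypeR R =>
    (\1_(`]-oo, b]%classic) l)%:E)) => [|l _].
    rewrite integral_indic// setIT.
    by rewrite [X in (X < _)%E](spectral_measure_half_line u b) ltry.
  by rewrite /= ger0_norm.
have ic (b c : R) : (dP u).-integrable setT
    (EFin \o (fun l => if l <= b then c else 0)).
  rewrite (_ : EFin \o _ = fun l => c%:E * (\1_(`]-oo, b]%classic) l)%:E)%E.
    exact: (integrableZl measurableT c (i1 b)).
  by apply/funext => l; rewrite /= half_lineE.
elim: r => [|[b c] r [ir IH]].
  rewrite big_nil (_ : step_real [::] = cst 0).
    by split; [exact: integrable0|rewrite integral0].
  by apply/funext => l; rewrite /step_real big_nil.
have E : EFin \o step_real ((b, c) :: r) =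
   ((EFin \o (fun l => if l <= b then c else 0)%R) \+ (EFin \o step_real r))%E.
  by apply/funext => l; rewrite /= /step_real big_cons.
split; first by rewrite E; exact: integrableD.
under eq_integral do rewrite -[_%:E]/((EFin \o step_real _) _) E.
rewrite integralD// IH big_cons/= EFinD; congr (_ + _)%E.
under eq_integral do rewrite half_lineE EFinM.
rewrite integralZl//; last exact: i1.
rewrite integral_indic// setIT EFinM; congr (_ * _)%E.
exact: spectral_measure_half_line.
Qed.

End HalfLine.

(** * Step functions and their spectral integrals *)

Section StepFun.
Context {R : realType}.
Implicit Types s t : seq (R * R[i]).

(** Opposites and products of step functions in the encoding by lists; the
    latter uses 1_(]-oo, a]) 1_(]-oo, b]) = 1_(]-oo, min a b]), which matches
    P_a P_b = P_min(a,b). *)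
Definition step_opp t : seq (R * R[i]) := [seq (j.1, - j.2) | j <- t].

Definition step_mul s t : seq (R * R[i]) :=
  [seq (Num.min i.1 j.1, i.2 * j.2) | i <- s, j <- t].

Lemma step_funB s t l :
  step_fun (s ++ step_opp t) l = step_fun s l - step_fun t l.
Proof.
rewrite /step_fun big_cat /= big_map -sumrN; congr (_ + _).
by apply: eq_bigr => j _ /=; case: ifP => _; rewrite ?oppr0.
Qed.

Lemma step_funM s t l : step_fun (step_mul s t) l = step_fun s l * step_fun t l.
Proof.
rewrite /step_fun /step_mul big_distrlr/= big_allpairs_dep/=.
apply: eq_bigr => i _; apply: eq_bigr => j _; rewrite le_min.
by case: (l <= i.1); case: (l <= j.1); rewrite /= ?mul0r ?mulr0.
Qed.

Lemma cmeasurable_step_fun s : cmeasurable (step_fun s : measurableTypeR R -> R[i]).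
Proof.
elim: s => [|[b c] s IH].
  rewrite (_ : step_fun _ = fun=> 0); first exact: cmeasurable_cst.
  by apply/funext => l; rewrite /step_fun big_nil.
rewrite (_ : step_fun _ =
    fun l => (\1_(`]-oo, b]%classic) l)%:C * c + step_fun s l).
  apply: cmeasurableD => //; apply: cmeasurableM; last exact: cmeasurable_cst.
  by split=> //=; apply: measurable_indic; exact: measurable_itv.
apply/funext => l; rewrite /step_fun big_cons; congr (_ + _).
rewrite -[\1_ _ _]mul1r -half_lineE /=.
by case: ifP => _; rewrite ?mul1r ?mul0r.
Qed.

Lemma step_fun_bounded s :
  exists2 K : R, 0 <= K & forall l, Normc.normc (step_fun s l) ^+ 2 <= K.
Proof.
elim: s => [|[b c] s [K K0 IH]].
  exists 0 => // l; rewrite /step_fun big_nil Normc.normc0 expr0n//.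
exists ((1 + 1) * Normc.normc c ^+ 2 + (1 + 1^-1) * K) => [|l].
  by rewrite addr_ge0// mulr_ge0// ?sqr_ge0// invr1 addr_ge0.
rewrite /step_fun big_cons; apply: le_trans (normc_sqrD_le _ _ ltr01) _.
apply: lerD; rewrite ler_pM2l ?invr1 ?addr_gt0//=; last exact: IH.
by case: ifP => _//; rewrite Normc.normc0 expr0n sqr_ge0.
Qed.

End StepFun.

Section StepIntegral.
Context {d : measure_display} {T : measurableType d} {R : realType}.
Variable mu : {measure set T -> \bar R}.
Variable P : resolution_of_identity mu.
Implicit Types (u v w : L2 mu) (s t : seq (R * R[i])) (f g : R -> R[i]).

Local Notation dP u := (spectral_measure P u).

Lemma step_integralB s t u :
  step_integral P (s ++ step_opp t) u = step_integral P s u - step_integral P t u.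
Proof.
rewrite /step_integral big_cat /= big_map -sumrN; congr (_ + _).
by apply: eq_bigr => j _ /=; rewrite scaleNr.
Qed.

Lemma step_integralM s t u :
  step_integral P (step_mul s t) u = step_integral P s (step_integral P t u).
Proof.
rewrite /step_integral /step_mul big_allpairs_dep/=.
apply: eq_bigr => i _; rewrite linear_sum scaler_sumr.
by apply: eq_bigr => j _; rewrite linearZ /= roi_comp scalerA.
Qed.

Lemma step_integral_linearB s u v :
  step_integral P s (u - v) = step_integral P s u - step_integral P s v.
Proof.
rewrite /step_integral -sumrB; apply: eq_bigr => j _.
by rewrite linearB scalerBr.
Qed.

(** ||u - P_b u||^2 = ||u||^2 - ||P_b u||^2 is nonnegative. *)
Lemma L2norm_proj_le (b : R) u : L2norm (P b u) ^+ 2 <= L2norm u ^+ 2.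
Proof.
have := sqr_ge0 (L2norm (u - P b u)); rewrite L2norm_sqrB.
have -> : L2dot u (P b u) = L2dot (P b u) (P b u).
  by rewrite roi_selfadjoint roi_comp minxx.
rewrite -L2norm_sqr; lra.
Qed.

Lemma step_integral_bounded s :
  exists2 K : R, 0 <= K &
    forall u, L2norm (step_integral P s u) ^+ 2 <= K * L2norm u ^+ 2.
Proof.
elim: s => [|[b c] s [K K0 IH]].
  by exists 0 => // u; rewrite /step_integral big_nil mul0r L2norm_sqr L2dot0l.
exists ((1 + 1) * Normc.normc c ^+ 2 + (1 + 1^-1) * K) => [|u].
  by rewrite addr_ge0// mulr_ge0// ?sqr_ge0// invr1 addr_ge0.
rewrite /step_integral big_cons; apply: le_trans (L2norm_sqrD_le _ _ ltr01) _.
rewrite [leRHS]mulrDl -(mulrA (1 + 1)) -(mulrA (1 + 1^-1)).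
apply: lerD; rewrite ler_pM2l ?invr1 ?addr_gt0//; last exact: IH.
by rewrite L2norm_sqrZ; apply: ler_wpM2l; rewrite ?sqr_ge0// L2norm_proj_le.
Qed.

Lemma L2dot_proj (a b : R) u :
  L2dot (P a u) (P b u) = (spectral_cdf P u (Num.min a b))%:C.
Proof.
rewrite roi_selfadjoint roi_comp.
set c := Num.min a b.
have -> : L2dot u (P c u) = L2dot (P c u) (P c u).
  by rewrite roi_selfadjoint roi_comp minxx.
rewrite /spectral_cdf L2norm_sqr.
have /(congr1 (@complex.Im _)) := L2dotC (P c u) (P c u).
case: (L2dot (P c u) (P c u)) => x y /= h.
by apply/eqP; rewrite eq_complex /= eqxx /=; apply/eqP; lra.
Qed.

Lemma L2dot_suml (I : Type) (r : seq I) (F : I -> L2 mu) w :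
  L2dot (\sum_(i <- r) F i) w = \sum_(i <- r) L2dot (F i) w.
Proof.
elim: r => [|i r IH]; first by rewrite !big_nil L2dot0l.
by rewrite !big_cons L2dotDl IH.
Qed.

Lemma L2dot_sumr (I : Type) (r : seq I) (F : I -> L2 mu) w :
  L2dot w (\sum_(i <- r) F i) = \sum_(i <- r) L2dot w (F i).
Proof.
elim: r => [|i r IH]; first by rewrite !big_nil L2dot0r.
by rewrite !big_cons L2dotDr IH.
Qed.

(** An encoding of the square of the modulus of a step function: expand the
    square into a double sum. *)
Definition step_normsq s : seq (R * R) :=
  [seq (Num.min i.1 j.1, complex.Re (i.2 * (j.2)^*)) | i <- s, j <- s].

Lemma step_real_normsq s l :
  step_real (step_normsq s) l = Normc.normc (step_fun s l) ^+ 2.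
Proof.
have -> : Normc.normc (step_fun s l) ^+ 2 =
    complex.Re (step_fun s l * (step_fun s l)^*).
  by rewrite normc_sqr; case: (step_fun s l) => x y /=; ring.
rewrite /step_fun rmorph_sum/= big_distrlr/= raddf_sum /step_real.
rewrite /step_normsq big_allpairs_dep/=; apply: eq_bigr => i _.
rewrite raddf_sum; apply: eq_bigr => j _; rewrite le_min.
by case: (l <= i.1); case: (l <= j.1); lazy iota;
  rewrite ?raddf0 ?mulr0 ?mul0r ?raddf0.
Qed.

(** The isometry for step functions.  Both sides expand into the same double
    sum over pairs (a, x), (b, y) of the terms
    Re (x conj(y)) ||P_min(a,b) u||^2. *)
Lemma sqint_step_fun s u :
  sqint (dP u) (step_fun s) = ((L2norm (step_integral P s u) ^+ 2)%:E)%E.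
Proof.
rewrite /sqint; under eq_integral do rewrite -step_real_normsq.
rewrite (integral_step_real P u _).2; congr (_%:E).
rewrite L2norm_sqr /step_integral L2dot_suml /step_normsq big_allpairs_dep/=.
rewrite raddf_sum; apply: eq_bigr => i _; rewrite L2dot_sumr raddf_sum.
apply: eq_bigr => j _; rewrite L2dotZl L2dotZr L2dot_proj /=.
by case: (i.2) (j.2) => [? ?] [? ?] /=; ring.
Qed.

End StepIntegral.

(** * Spectral integrals *)

Section SpectralIntegral.
Context {d : measure_display} {T : measurableType d} {R : realType}.
Variable mu : {measure set T -> \bar R}.
Variable P : resolution_of_identity mu.
Implicit Types (u v w : L2 mu) (s t : seq (R * R[i])) (f g : R -> R[i]).

Local Notation dP u := (spectral_measure P u).
Local Notation normsq f u := (sqint (dP u) (f : measurableTypeR R -> R[i])).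

Lemma spectral_integral_meas f u w : spectral_integral P f u w ->
  cmeasurable (f : measurableTypeR R -> R[i]).
Proof. by case. Qed.

Lemma L2norm_le_sqr u (e : R) : 0 <= e ->
  (L2norm u <= e) = (L2norm u ^+ 2 <= e ^+ 2).
Proof. by move=> e0; rewrite ler_sqr ?nnegrE// L2norm_ge0. Qed.

Lemma spectral_integralP f u w : spectral_integral P f u w <->
  cmeasurable (f : measurableTypeR R -> R[i]) /\
  forall e : R, 0 < e -> exists s,
    (normsq (fun l => f l - step_fun s l)%R u <= e%:E)%E /\
    L2norm (step_integral P s u - w) <= e.
Proof. by split=> [[mr mi h]|[[mr mi] h]]; split. Qed.

(** Both errors are stated for squared norms, the form in which
    [le_of_approx] consumes them. *)
Lemma spectral_integral_approx f u w (z : R) : spectral_integral P f u w ->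
  0 < z -> exists s,
    (normsq (fun l => f l - step_fun s l)%R u <= z%:E)%E /\
    L2norm (step_integral P s u - w) ^+ 2 <= z.
Proof.
move=> [_ _ h] z0; pose e := Num.min z 1.
have e0 : 0 < e by rewrite lt_min z0 ltr01.
have ez : e <= z by rewrite ge_min lexx.
have e1 : e <= 1 by rewrite ge_min lexx orbT.
have [s [h1 h2]] := h e e0; exists s; split.
  by apply: le_trans h1 _; rewrite lee_fin.
rewrite (L2norm_le_sqr _ (ltW e0)) in h2; apply: le_trans h2 _.
by apply: le_trans ez; rewrite expr2 ler_piMl// ltW.
Qed.

Lemma sqint_opp f u : normsq (fun l => - f l) u = normsq f u.
Proof.
apply: eq_integral => l _; congr (_%:E); rewrite !normc_sqr.
by case: (f l) => x y /=; rewrite !sqrrN.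
Qed.

(** The isometry passes to the limit.  Finiteness of the integral comes first,
    from a single approximation; then each inequality is an instance of
    [le_of_approx], the common approximant being a step function. *)
Lemma spectral_integral_sqint f u w : spectral_integral P f u w ->
  normsq f u = (L2norm w ^+ 2)%:E.
Proof.
move=> fuw; have mf := spectral_integral_meas fuw.
have ms s : cmeasurable (step_fun s : measurableTypeR R -> R[i]).
  exact: cmeasurable_step_fun.
have le1 s (e : R) : 0 < e -> (normsq f u <= (1 + e)%:E *
    (L2norm (step_integral P s u) ^+ 2)%:E +
    (1 + e^-1)%:E * normsq (fun l => f l - step_fun s l)%R u)%E.
  move=> e0; rewrite -sqint_step_fun.
  apply: le_trans (sqintD_le _ e0 (ms s) (cmeasurableB mf (ms s))).
  rewrite le_eqVlt; apply/orP; left; apply/eqP; congr sqint.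
  by apply/funext => l; rewrite addrC subrK.
have fin : normsq f u \is a fin_num.
  rewrite ge0_fin_numE ?sqint_ge0//.
  have [s [h1 h2]] := spectral_integral_approx fuw ltr01.
  apply: le_lt_trans (le1 s 1 ltr01) _.
  rewrite lte_add_pinfty// ?lte_mul_pinfty ?lee_fin ?invr1 ?addr_ge0 ?ltry//.
  by apply: le_lt_trans h1 _; rewrite ltry.
have fz z s : (normsq (fun l => f l - step_fun s l)%R u <= z%:E)%E ->
    exists2 J : R, normsq (fun l => f l - step_fun s l)%R u = J%:E & J <= z.
  move: (normsq _ _) (sqint_ge0 (dP u) (fun l => f l - step_fun s l)).
  by case=> // J _; rewrite lee_fin; exists J.
rewrite -(fineK fin); set I := fine _.
have I0 : 0 <= I by rewrite fine_ge0// sqint_ge0.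
congr (_%:E); apply/eqP; rewrite eq_le; apply/andP; split.
  apply: le_of_approx; first exact: sqr_ge0.
  move=> e z e0 z0; have [s [h1 h2]] := spectral_integral_approx fuw z0.
  exists (L2norm (step_integral P s u) ^+ 2); split.
    have := le1 s e e0; rewrite -(fineK fin) -/I.
    have [J -> Jz] := fz _ _ h1.
    rewrite -!EFinM -EFinD lee_fin => /le_trans; apply.
    by rewrite lerD2l ler_wpM2l// addr_ge0// invr_ge0 ltW.
  have := L2norm_sqrD_le w (step_integral P s u - w) e0.
  rewrite addrC subrK => /le_trans; apply.
  by rewrite lerD2l ler_wpM2l// addr_ge0// invr_ge0 ltW.
apply: le_of_approx => // e z e0 z0.
have [s [h1 h2]] := spectral_integral_approx fuw z0.
exists (L2norm (step_integral P s u) ^+ 2); split.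
  have := L2norm_sqrD_le (step_integral P s u) (- (step_integral P s u - w)) e0.
  rewrite L2normN opprB addrC subrK => /le_trans; apply.
  by rewrite lerD2l ler_wpM2l// addr_ge0// invr_ge0 ltW.
have := sqintD_le (dP u) e0 mf (cmeasurableB (ms s) mf).
rewrite (_ : (fun x => _) = step_fun s); last first.
  by apply/funext => l; rewrite addrC subrK.
rewrite sqint_step_fun -(fineK fin) -/I.
rewrite (_ : (fun x => _) = (fun l => - (f l - step_fun s l))); last first.
  by apply/funext => l; rewrite opprB.
have [J JE Jz] := fz _ _ h1; rewrite sqint_opp JE.
rewrite -!EFinM -EFinD lee_fin => /le_trans; apply.
by rewrite lerD2l ler_wpM2l// addr_ge0// invr_ge0 ltW.
Qed.

Lemma L2normD_le2 u v (e : R) : 0 <= e -> L2norm u <= e -> L2norm v <= e ->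
  L2norm (u + v) <= 2 * e.
Proof.
move=> e0; rewrite !L2norm_le_sqr ?mulr_ge0// => hu hv.
by have := L2norm_sqrD_le u v ltr01; rewrite invr1; lra.
Qed.

Lemma sqintD_le2 f g u (e : R) : 0 <= e ->
  cmeasurable (f : measurableTypeR R -> R[i]) ->
  cmeasurable (g : measurableTypeR R -> R[i]) ->
  (normsq f u <= e%:E)%E -> (normsq g u <= e%:E)%E ->
  (normsq (fun l => f l + g l)%R u <= (4 * e)%:E)%E.
Proof.
move=> e0 mf mg hf hg; apply: le_trans (sqintD_le _ ltr01 mf mg) _.
rewrite invr1 (_ : 4 * e = (1 + 1) * e + (1 + 1) * e); last by ring.
by rewrite [X in (_ <= X)%E]EFinD !EFinM; apply: leeD;
  apply: lee_wpmul2l; rewrite ?lee_fin ?addr_ge0.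
Qed.

Lemma spectral_integralB f g u v w : spectral_integral P f u v ->
  spectral_integral P g u w ->
  spectral_integral P (fun l => f l - g l) u (v - w).
Proof.
move=> /spectral_integralP[mf hf] /spectral_integralP[mg hg].
apply/spectral_integralP; split=> [|e e0]; first exact: cmeasurableB.
have e4 : 0 < e / 4 by rewrite divr_gt0.
have [s [s1 s2]] := hf _ e4; have [t [t1 t2]] := hg _ e4.
have ms := cmeasurable_step_fun s; have mt := cmeasurable_step_fun t.
exists (s ++ step_opp t); split.
  rewrite -sqint_opp in t1.
  have mt' : cmeasurable
      (fun l : measurableTypeR R => - (g l - step_fun t l)).
    rewrite (_ : (fun l => _) = (fun l => step_fun t l - g l)).
      exact: cmeasurableB.
    by apply/funext => l; rewrite opprB.
  have := sqintD_le2 (ltW e4) (cmeasurableB mf ms) mt' s1 t1.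
  rewrite [4 * _]mulrC divfK// (_ : (fun l => _) =
    fun l => f l - g l - step_fun (s ++ step_opp t) l)//.
  by apply/funext => l; rewrite step_funB; ring.
rewrite step_integralB opprB [w - v]addrC addrACA [- step_integral P t u + w]addrC.
rewrite -[w - _]opprB.
apply: le_trans (L2normD_le2 (ltW e4) s2 _) _; first by rewrite L2normN.
by rewrite mulrC -mulrA ler_piMr// ?ltW//; lra.
Qed.

(** The difference of two values is the spectral integral of f - f = 0, so its
    norm vanishes by the isometry. *)
Lemma spectral_integral_unique f u w w' :
  spectral_integral P f u w -> spectral_integral P f u w' -> w = w'.
Proof.
move=> fw fw'; apply/eqP; rewrite -subr_eq0; apply/eqP; apply: L2norm_eq0.
have := spectral_integral_sqint (spectral_integralB fw fw').
rewrite /sqint; under eq_integral do rewrite subrr Normc.normc0 expr0n.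
by rewrite integral0 => -[/esym/eqP]; rewrite sqrf_eq0 => /eqP.
Qed.

(** The composition rule when the outer function is a step function [s]: then
    [s] is bounded and so is s(P), and therefore approximations of [g] are
    turned into approximations of s g by multiplication by [s]. *)
Lemma spectral_integral_step s g u v : spectral_integral P g u v ->
  spectral_integral P (fun l => step_fun s l * g l) u (step_integral P s v).
Proof.
move=> /spectral_integralP[mg hg]; have ms := cmeasurable_step_fun s.
apply/spectral_integralP; split=> [|e e0]; first exact: cmeasurableM.
have [K1 K10 sK1] := step_fun_bounded s.
have [K2 K20 sK2] := step_integral_bounded P s.
(* K >= 1 ensures that K2 (e / K)^2 <= e^2, the norm being compared squared. *)
pose K := K1 + K2 + 1; have K0 : 0 < K by rewrite /K; lra.
have K1e : K1 * (e / K) <= e.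
  by rewrite mulrA ler_pdivrMr// mulrC ler_pM2l// /K; lra.
have K2e : K2 * (e / K) ^+ 2 <= e ^+ 2.
  rewrite expr_div_n mulrA ler_pdivrMr ?exprn_gt0// mulrC ler_pM2l ?exprn_gt0//.
  by rewrite /K; nra.
have eK : 0 < e / K by rewrite divr_gt0.
have [t [t1 t2]] := hg _ eK; have mt := cmeasurable_step_fun t.
exists (step_mul s t); split.
  have mgt := cmeasurableB mg mt.
  have := @sqint_le _ _ _ (dP u) K1
    (fun l : measurableTypeR R => step_fun s l * g l - step_fun (step_mul s t) l)
    _ K10 _ mgt.
  move=> /(_ _ _)/le_trans; apply.
  - by apply: cmeasurableB; [exact: cmeasurableM|exact: cmeasurable_step_fun].
  - move=> l; rewrite step_funM -mulrBr Normc.normcM exprMn.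
    by rewrite ler_wpM2r// sqr_ge0.
  - apply: (@le_trans _ _ (K1%:E * (e / K)%:E)%E).
      by rewrite lee_wpmul2l// lee_fin.
    by rewrite -EFinM lee_fin.
rewrite step_integralM -step_integral_linearB.
rewrite (L2norm_le_sqr _ (ltW e0)).
apply: le_trans (sK2 _) _; apply: le_trans K2e.
by rewrite ler_wpM2l// -(L2norm_le_sqr _ (ltW eK)).
Qed.

(** P_b v is the spectral integral of g cut off at b, so this is the isometry
    for the latter. *)
Lemma spectral_cdf_spectral_integral g u v (b : R) : spectral_integral P g u v ->
  ((spectral_cdf P v b)%:E =
    \int[dP u]_(l in `]-oo, b]) (Normc.normc (g l) ^+ 2)%:E)%E.
Proof.
move=> guv; have := spectral_integral_sqint (spectral_integral_step [:: (b, 1)] guv).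
rewrite /step_integral big_seq1 scale1r => <-.
rewrite integral_mkcond; apply: eq_integral => l _.
rewrite /step_fun big_seq1 patchE /=.
have -> : (l \in `]-oo, b]%classic) = (l <= b).
  by apply/idP/idP; rewrite ?inE /= ?in_itv.
by case: ifP => _; rewrite ?mul1r// mul0r Normc.normc0 expr0n.
Qed.

End SpectralIntegral.

(** * Composition of spectral integrals *)

Section Composition.
Context {d : measure_display} {T : measurableType d} {R : realType}.
Variable mu : {measure set T -> \bar R}.
Variable P : resolution_of_identity mu.
Implicit Types (u v w : L2 mu) (f g : R -> R[i]).

Local Notation dP u := (spectral_measure P u).

(** A Stieltjes measure is determined by its values on the intervals ]a, b],
    which are differences of values on half-lines. *)
Lemma spectral_measure_density g u v
    (mg : measurable_fun setT
       (fun l : measurableTypeR R => Normc.normc (g l) ^+ 2))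
    (g0 : forall l : measurableTypeR R, 0 <= Normc.normc (g l) ^+ 2) :
  spectral_integral P g u v ->
  forall A, measurable A -> dP v A = density (dP u) mg g0 A.
Proof.
move=> guv; apply: lebesgue_stieltjes_measure_unique => X.
have half b : density (dP u) mg g0 `]-oo, b]%classic = (spectral_cdf P v b)%:E.
  exact/esym/(spectral_cdf_spectral_integral b guv).
move=> /ocitvP[->|[[a b] /= ab ->]]; first by rewrite !measure0.
have mI (i : interval R) : measurable ([set` i] : set (measurableTypeR R)).
  exact: measurable_itv.
have h : (density (dP u) mg g0 `]-oo, b]%classic =
    density (dP u) mg g0 `]-oo, a]%classic + density (dP u) mg g0 `]a, b]%classic)%E.
  rewrite (@itv_bndbnd_setU _ _ -oo%O (BRight a)) ?bnd_simp ?ltW// measureU//.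
  apply/seteqP; split=> // x /= []; rewrite !in_itv/= => xa /andP[ax _].
  by move: (lt_le_trans ax xa); rewrite ltxx.
rewrite !half in h; rewrite -[LHS]/(dP v `]a, b]%classic).
by rewrite spectral_measure_itvoc ?ltW// EFinB h addeAC subee// add0e.
Qed.

Lemma sqint_spectral_integral f g u v : spectral_integral P g u v ->
  cmeasurable (f : measurableTypeR R -> R[i]) ->
  sqint (dP v) (f : measurableTypeR R -> R[i]) =
  sqint (dP u) ((fun l => f l * g l) : measurableTypeR R -> R[i]).
Proof.
move=> guv mf; have mg := spectral_integral_meas guv.
have mg2 := measurable_normc_sqr mg.
have g0 (l : measurableTypeR R) : 0 <= Normc.normc (g l) ^+ 2 by exact: sqr_ge0.
transitivity (\int[density (dP u) mg2 g0]_l (Normc.normc (f l) ^+ 2)%:E)%E.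
  apply: eq_measure_integral => A mA _.
  exact: spectral_measure_density.
rewrite integral_density; last 2 first.
- exact/measurable_EFinP/measurable_normc_sqr.
- by move=> l; rewrite lee_fin sqr_ge0.
by apply: eq_integral => l _; rewrite -EFinM Normc.normcM exprMn.
Qed.

(** Choose a step function [s] close to [f] in L^2 of the spectral measure of
    [v].  By the change of density, s g is close to f g in L^2 of the spectral
    measure of [u], and s g is approximated by step functions [t] since
    s(P) v = (s g)(P) u. *)
Lemma spectral_integral_comp f g u v w :
  spectral_integral P g u v -> spectral_integral P f v w ->
  spectral_integral P (fun l => f l * g l) u w.
Proof.
move=> guv /spectral_integralP[mf hf]; have mg := spectral_integral_meas guv.
apply/spectral_integralP; split=> [|e e0]; first exact: cmeasurableM.
have e4 : 0 < e / 4 by rewrite divr_gt0.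
have [s [s1 s2]] := hf _ e4; have ms := cmeasurable_step_fun s.
have /spectral_integralP[_ /(_ _ e4)[t [t1 t2]]] := spectral_integral_step s guv.
have mt := cmeasurable_step_fun t.
exists t; split.
  have mfs := cmeasurableB mf ms.
  rewrite (sqint_spectral_integral guv mfs) in s1.
  have := sqintD_le2 (ltW e4) (cmeasurableM mfs mg)
    (cmeasurableB (cmeasurableM ms mg) mt) s1 t1.
  rewrite [4 * _]mulrC divfK// (_ : (fun l => _) =
    fun l => f l * g l - step_fun t l)//.
  by apply/funext => l; ring.
rewrite -[_ - w](subrKA (step_integral P s v)).
apply: le_trans (L2normD_le2 (ltW e4) t2 s2) _.
by rewrite mulrC -mulrA ler_piMr// ?ltW//; lra.
Qed.

(** For m > 0, (1 + l)^s and (1 + l)^(-s) cancel on (0, +oo), and the product is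
    0 elsewhere because the inner factor is. *)
Lemma symbol_operator_spectral_integral (dim m : R) p u w :
  symbol_operator P dim m p u w ->
  spectral_integral P (fun l => if 0 < l then p l else 0) u w.
Proof.
rewrite /symbol_operator; case: ifP => _ //.
move=> [v [quv bvw]]; have := spectral_integral_comp quv bvw.
rewrite (_ : (fun l => _) = fun l => if 0 < l then p l else 0)//.
apply/funext => l; case: ifP => l0; last by rewrite mulr0.
rewrite mulrA -rmorphM /= -powRD ?subrr ?powRr0 ?mul1r//.
by apply/implyP => _; rewrite gt_eqF// addr_gt0.
Qed.

End Composition.

Unset Implicit Arguments.

Theorem proposition3p4 (R : realType) (X : pointedMetricType R)
  (mu : {measure set (borel X) -> \bar R})
  (mu_doubling : doubling mu)
  (Delta : unbounded_operator mu)
  (Delta_sa : self_adjoint Delta)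
  (Delta_np : non_positive Delta)
  (P : resolution_of_identity mu)
  (P_Delta : spectral_resolution_opp Delta P)
  (d gamma c1 c2 : R)
  (d_gt0 : 0 < d) (gamma_gt0 : 0 < gamma) (c1_gt0 : 0 < c1) (c2_gt0 : 0 < c2)
  (h : R[i] -> X -> X -> R[i])
  (h_heat : heat_kernel P d gamma c1 c2 h)
  (m1 m2 : R) (p1 p2 : R -> R[i])
  (p1_symbol : symbol d m1 p1) (p2_symbol : symbol d m2 p2) :
  let p12 := fun l => p1 l * p2 l in
  symbol d (m1 + m2) p12 /\
  forall u w w' : L2 mu,
    op_comp (symbol_operator P d m1 p1) (symbol_operator P d m2 p2) u w ->
    symbol_operator P d (m1 + m2) p12 u w' ->
    w = w'.
Proof.
split; first exact: symbolM.
move=> u w w' [v [op2 op1]] op12.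
apply: (spectral_integral_unique (spectral_integral_comp
  (symbol_operator_spectral_integral op2)
  (symbol_operator_spectral_integral op1))).
rewrite (_ : (fun l => _) = fun l => if 0 < l then p1 l * p2 l else 0).
  exact: (symbol_operator_spectral_integral op12).
by apply/funext => l; case: ifP => _; rewrite ?mulr0.
Qed.
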